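(* Let $X$ be a compact connected Kähler manifold of complex dimension $n\ge1$ and $\omega$ a positive closed $(1,1)$-current on $X$ with bounded potentials and $\int_X\omega^n>0$. Then $$\mathcal{E}(X,\omega)=\bigcup_{\chi\in\mathcal{W}^-}\mathcal{E}_\chi(X,\omega).$$
   Context: Notation: $\mathbb{R}^-=(-\infty,0]$, $d=\partial+\overline{\partial}$, $d^c=\frac{1}{2i\pi}(\partial-\overline{\partial})$. $PSH(X,\omega)$ is the set of upper semicontinuous functions $\varphi\in L^1(X)$ with $dd^c\varphi\ge-\omega$. For bounded $\varphi\in PSH(X,\omega)$, $(\omega+dd^c\varphi)^n$ is the Bedford–Taylor Monge–Ampère measure. For arbitrary $\varphi\in PSH(X,\omega)$ put $\varphi_j:=\max(\varphi,-j)$; the measures $\mathbf{1}_{\{\varphi>-j\}}(\omega+dd^c\varphi_j)^n$ are nondecreasing in $j$ with total mass at most $\int_X\omega^n$, and $\mu_\varphi:=\lim_{j\to+\infty}\mathbf{1}_{\{\varphi>-j\}}(\omega+dd^c\varphi_j)^n$. Define $\mathcal{E}(X,\omega):=\{\varphi\in PSH(X,\omega)\ :\ \mu_\varphi(X)=\int_X\omega^n\}$, and for $\varphi\in\mathcal{E}(X,\omega)$ write $(\omega+dd^c\varphi)^n:=\mu_\varphi$. $\mathcal{W}^-$ is the set of convex increasing functions $\chi:\mathbb{R}^-\to\mathbb{R}^-$ with $\chi(0)=0$ and $\chi(-\infty)=-\infty$. For such $\chi$, $\mathcal{E}_\chi(X,\omega):=\{\varphi\in\mathcal{E}(X,\omega)\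 :\ \chi(-|\varphi|)\in L^1((\omega+dd^c\varphi)^n)\}$. *)

(* Defs.v *)
From HB Require Import structures.
From mathcomp Require Import all_boot all_order all_algebra.
From mathcomp Require Import complex.
From mathcomp Require Import all_classical all_reals all_analysis.

Set Implicit Arguments.
Unset Strict Implicit.
Unset Printing Implicit Defensive.
Import Order.TTheory GRing.Theory Num.Theory.
Import numFieldNormedType.Exports.
Local Open Scope classical_set_scope.
Local Open Scope complex_scope.
Local Open Scope ring_scope.

Notation borel T := (g_sigma_algebraType (@open T)).

(* The default value 0 is only used when no measure satisfies [P]. *)
Definition the_finite_measure (R : realType) (d : measure_display)
    (T : measurableType d) (P : {finite_measure set T -> \bar R} -> Prop) :
    {finite_measure set T -> \bar R} :=
  if pselect (exists mu, P mu) is left h then projT1 (cid h)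
  else (mzero : {finite_measure set T -> \bar R}).

(* C^n in real coordinates: z = (x, y) stands for (x_p + i y_p)_p.  The type
   R[i] carries no topology in the library, hence complex-valued functions are
   handled through their real and imaginary parts. *)
Notation Cn R n := ('rV[R]_n * 'rV[R]_n)%type.

Section complex_space.
Context {R : realType} {n : nat}.
Local Notation C := (Cn R n).
Implicit Types (z w : C) (U V : set C) (f g : C -> R[i]).

Definition zcoord (r : 'I_n) z : R[i] := z.1 0 r +i* z.2 0 r.

Definition zscale (a : R[i]) w : C :=
  (complex.Re a *: w.1 - complex.Im a *: w.2,
   complex.Re a *: w.2 + complex.Im a *: w.1).

Definition dirder w f : C -> R[i] := fun z =>
  'D_w (fun x => complex.Re (f x) : R) z +i* 'D_w (fun x => complex.Im (f x) : R) z.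

Definition dx (p : 'I_n) : C := (delta_mx 0 p, 0).
Definition dy (p : 'I_n) : C := (0, delta_mx 0 p).

(* Wirtinger operators d/dz_p and d/dzbar_p *)
Definition dz (p : 'I_n) f : C -> R[i] := fun z =>
  2^-1 * (dirder (dx p) f z - (0 +i* 1) * dirder (dy p) f z).
Definition dzb (p : 'I_n) f : C -> R[i] := fun z =>
  2^-1 * (dirder (dx p) f z + (0 +i* 1) * dirder (dy p) f z).

Definition cdifferentiable f z :=
  differentiable (fun x => complex.Re (f x) : R) z /\
  differentiable (fun x => complex.Im (f x) : R) z.

Definition smooth_on U f := forall (s : seq C) z, U z ->
  cdifferentiable (foldr dirder f s) z.

Definition holomorphic_on U f := forall z, U z ->
  cdifferentiable f z /\ forall p, dzb p f z = 0.

Definition supported_in U f := forall z, ~ U z -> f z = 0.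

Definition test_function U f := smooth_on setT f /\
  exists K : set C, [/\ compact K, K `<=` U & supported_in K f].

Definition is_distribution U (T : (C -> R[i]) -> R[i]) :=
  (forall (a : R[i]) f g, test_function U f -> test_function U g ->
     T (fun z => a * f z + g z) = a * T f + T g) /\
  (forall K : set C, compact K -> K `<=` U -> exists (c : R) (N : nat),
     forall f (M : R), test_function U f -> supported_in K f ->
       (forall (s : seq C) z, (size s <= N)%N -> {in s, forall w, `|w| <= 1} ->
          `|foldr dirder f s z| <= M%:C) ->
       `|T f| <= (c * M)%:C).

Definition box z w : set C := [set x : C |
  forall p, [/\ z.1 0 p <= x.1 0 p <= w.1 0 p & z.2 0 p <= x.2 0 p <= w.2 0 p]].

(* the Borel measure characterized by the volume of boxes *)
Definition lebesgueC : {measure set (borel C) -> \bar R} :=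
  let P (m : {measure set (borel C) -> \bar R}) := forall z w,
    (forall p, z.1 0 p <= w.1 0 p /\ z.2 0 p <= w.2 0 p) ->
    m (box z w) =
      (\prod_(p < n) ((w.1 0 p - z.1 0 p) * (w.2 0 p - z.2 0 p)))%:E in
  if pselect (exists m, P m) is left h then projT1 (cid h)
  else (mzero : {measure set (borel C) -> \bar R}).

End complex_space.

Definition cint {R : realType} {d : measure_display} {T : measurableType d}
    (mu : {measure set T -> \bar R}) (D : set T) (f : T -> R[i]) : R[i] :=
  (\int[mu]_(x in D) complex.Re (f x)) +i* (\int[mu]_(x in D) complex.Im (f x)).

Section pluripotential.
Context {R : realType} {n : nat}.
Local Notation C := (Cn R n).
Implicit Types (z w : C) (U V : set C) (f : C -> R[i]) (v : C -> R).

Definition bounded_psh V v :=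
  [/\ exists M : R, forall z, V z -> `|v z| <= M,
      forall z (a : R), V z -> v z < a -> \forall w \near z, v w < a &
      forall z w, (forall a : R[i], `|a| <= 1 -> V (z + zscale a w)) ->
        2 * pi * v z <=
        \int[lebesgue_measure]_(t in `[0, 2 * pi])
          v (z + zscale (cos t +i* sin t) w)].

(* Coefficient (p, q) of dd^c v on V.  As d^c = (1 / 2 i pi) (del - delbar), one
   has dd^c = (i / pi) del delbar; (1,1)-currents are written
   (i / pi) \sum_(p, q) T_(p, q) dz_p /\ dzbar_q throughout. *)
Definition ddc_coef V v (p q : 'I_n) f : R[i] :=
  cint lebesgueC V (fun z => (v z)%:C * dz p (dzb q f) z).

(* A complex Radon measure in polar form: density with respect to a positive
   measure. *)
Record cmeasure := CMeasure {
  cm_abs : {measure set (borel C) -> \bar R};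
  cm_dens : C -> R[i] }.

Definition cm_radon V (T : cmeasure) := forall K : set C, compact K -> K `<=` V ->
  (cm_abs T).-integrable K (fun z => (complex.Re (cm_dens T z))%:E) /\
  (cm_abs T).-integrable K (fun z => (complex.Im (cm_dens T z))%:E).

Definition cm_pair V (T : cmeasure) f : R[i] :=
  cint (cm_abs T) V (fun z => f z * cm_dens T z).

Definition position (p : 'I_n) (I : {set 'I_n}) : nat := #|[set i in I | (i < p)%N]|.

(* Bedford-Taylor induction (dd^c v)^(k+1) := dd^c (v (dd^c v)^k).  For
   #|I| = #|J| = k, [T I J] is the coefficient of (dd^c v)^k on
   (i/pi)^k dz_(i_1) /\ dzbar_(j_1) /\ ... /\ dz_(i_k) /\ dzbar_(j_k), where
   i_1 < ... < i_k and j_1 < ... < j_k enumerate I and J; being a positive closed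
   current, (dd^c v)^k has measure coefficients, so that v can be multiplied
   with it. The sign comes from reordering dz_p /\ dzbar_q to its place. *)
Definition bedford_taylor V v (T : {set 'I_n} -> {set 'I_n} -> cmeasure) :=
  [/\ T finset.set0 finset.set0 = CMeasure lebesgueC (fun=> 1),
      forall I J : {set 'I_n}, #|I| = #|J| -> cm_radon V (T I J) &
      forall (I J : {set 'I_n}) f, #|I| = #|J| -> (0 < #|I|)%N -> test_function V f ->
        cm_pair V (T I J) f =
        \sum_(p in I) \sum_(q in J) (-1) ^+ (position p I + position q J) *
          cm_pair V (T (I :\ p)%SET (J :\ q)%SET)
            (fun z => (v z)%:C * dz p (dzb q f) z)].

(* The (n,n)-current (dd^c v)^n as a linear form on functions:
   (i/pi)^n dz_1 /\ dzbar_1 /\ ... /\ dz_n /\ dzbar_n = (2/pi)^n Lebesgue. *)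
Definition is_ddc_pow V v (L : (C -> R[i]) -> R[i]) :=
  exists2 T, bedford_taylor V v T &
    forall f, test_function V f ->
      L f = ((2 / pi) ^+ n)%:C * cm_pair V (T [set: 'I_n]%SET [set: 'I_n]%SET) f.

End pluripotential.
Arguments cmeasure : clear implicits.

Record chart (R : realType) (n : nat) (X : ptopologicalType) := Chart {
  dom : set X;
  cod : set (Cn R n);
  fwd : X -> Cn R n;
  bwd : Cn R n -> X }.

Section manifold.
Context {R : realType} {n : nat} {X : ptopologicalType}.
Local Notation C := (Cn R n).
Local Notation chart := (chart R n X).
Implicit Types (c d : chart) (A : set chart).

Definition is_chart c :=
  [/\ open (dom c) /\ open (cod c),
      forall x, dom c x -> cod c (fwd c x) /\ bwd c (fwd c x) = x,
      forall z, cod c z -> dom c (bwd c z) /\ fwd c (bwd c z) = z,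
      forall x, dom c x -> {for x, continuous (fwd c)} &
      forall z, cod c z -> {for z, continuous (bwd c)}].

Definition trans c d : C -> C := fun z => fwd d (bwd c z).
Definition trans_dom c d : set C := cod c `&` bwd c @^-1` dom d.

Definition complex_atlas A :=
  [/\ forall c, A c -> is_chart c,
      forall x, exists2 c, A c & dom c x &
      forall c d r, A c -> A d ->
        holomorphic_on (trans_dom c d) (fun z => zcoord r (trans c d z))].

Definition jac c d (z : C) : 'M[R[i]]_n :=
  \matrix_(r, p) dz p (fun w => zcoord r (trans c d w)) z.

(* Kaehler form i \sum_(p, q) h_(p, q) dz_p /\ dzbar_q; over the complex numbers
   positive definiteness as stated includes the Hermitian symmetry. *)
Definition kahler_form A (h : chart -> C -> 'M[R[i]]_n) :=
  [/\ forall c p q, A c -> smooth_on (cod c) (fun z => h c z p q),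
      forall c z (l : 'I_n -> R[i]), A c -> cod c z -> (exists p, l p != 0) ->
        0 < \sum_p \sum_q l p * (l q)^* * h c z p q,
      forall c z k p q, A c -> cod c z ->
        dz k (fun w => h c w p q) z = dz p (fun w => h c w k q) z /\
        dzb k (fun w => h c w p q) z = dzb q (fun w => h c w p k) z &
      forall c d z p q, A c -> A d -> trans_dom c d z ->
        h c z p q = \sum_r \sum_s
          h d (trans c d z) r s * jac c d z r p * (jac c d z s q)^*].

Definition kahler A := exists h, kahler_form A h.

(* (1,1)-currents as differential forms with distribution coefficients:
   [T c p q] is the coefficient of T in the chart c (normalized as in
   [ddc_coef]), paired with test functions on [cod c]. *)
Definition current := chart -> 'I_n -> 'I_n -> (C -> R[i]) -> R[i].
Implicit Types T : current.

(* The second clause is the transformation law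
   T^c_(p, q) = \sum_(r, s) tau^* T^d_(r, s) (d_p tau_r) (d_q tau_s)^*
   for tau = trans c d, after the change of variables w = tau z, whose inverse
   has real Jacobian |det (jac d c w)|^2. *)
Definition is_current A T :=
  (forall c p q, A c -> is_distribution (cod c) (T c p q)) /\
  (forall c d p q f, A c -> A d -> test_function (trans_dom c d) f ->
     T c p q f = \sum_r \sum_s T d r s (fun w =>
       if w \in trans_dom d c then
         let z := trans d c w in
         f z * jac c d z r p * (jac c d z s q)^* * `|\det (jac d c w)| ^+ 2
       else 0)).

Definition closed_current A T := forall c k p q f, A c -> test_function (cod c) f ->
  T c p q (dz k f) = T c k q (dz p f) /\ T c p q (dzb k f) = T c p k (dzb q f).

Definition positive_current A T :=
  forall c (l : 'I_n -> R[i]) f, A c -> test_function (cod c) f ->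
    (forall z, 0 <= f z) ->
    0 <= \sum_p \sum_q l p * (l q)^* * T c p q f.

Definition local_potential c T (V : set C) (v : C -> R) :=
  [/\ open V, V `<=` cod c, bounded_psh V v &
      forall p q f, test_function V f -> T c p q f = ddc_coef V v p q f].

Definition bounded_potentials A T := forall c z, A c -> cod c z ->
  exists V v, V z /\ local_potential c T V v.

(* Bedford-Taylor measure T^n of a positive closed (1,1)-current T with bounded
   potentials *)
Definition is_MA A T (mu : {finite_measure set (borel X) -> \bar R}) :=
  forall c z, A c -> cod c z -> exists V v,
    [/\ V z, local_potential c T V v &
        is_ddc_pow V v (fun f =>
          cint mu (dom c `&` fwd c @^-1` V) (fun x => f (fwd c x)))].

Definition MA A T := the_finite_measure (is_MA A T).

(* omega + dd^c phi; an integrable phi is finite almost everywhere *)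
Definition add_ddc (omega : current) (phi : X -> \bar R) : current :=
  fun c p q f =>
    omega c p q f + ddc_coef (cod c) (fun z => fine (phi (bwd c z))) p q f.

Definition PSH A (omega : current) : set (X -> \bar R) := [set phi : X -> \bar R |
  [/\ forall x, (phi x < +oo)%E,
      forall x a, (phi x < a%:E)%E -> \forall y \near x, (phi y < a%:E)%E,
      forall c (K : set C), A c -> compact K -> K `<=` cod c ->
        lebesgueC.-integrable K (fun z => phi (bwd c z)) &
      positive_current A (add_ddc omega phi)]].

Definition trunc (phi : X -> \bar R) (j : nat) : X -> \bar R :=
  fun x => maxe (phi x) (- j%:R)%:E.

Definition is_np_MA A (omega : current) phi (mu : {finite_measure set (borel X) -> \bar R}) :=
  forall B : set (borel X), measurable B ->
    (fun j : nat => MA A (add_ddc omega (trunc phi j))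
                      (B `&` [set x | ((- j%:R)%:E < phi x)%E])) @ \oo --> mu B.

Definition np_MA A omega phi := the_finite_measure (is_np_MA A omega phi).

Definition Efull A omega : set (X -> \bar R) := [set phi : X -> \bar R |
  PSH A omega phi /\ np_MA A omega phi setT = MA A omega setT].

(* [er_map chi] extends chi by chi(-oo) = -oo *)
Definition Echi A omega (chi : R -> R) : set (X -> \bar R) := [set phi : X -> \bar R |
  Efull A omega phi /\
  (np_MA A omega phi).-integrable setT (fun x => er_map chi (- `|phi x|)%E)].

End manifold.
Arguments current : clear implicits.

(* Elements of W^- are represented by functions on R whose values outside
   ]-oo, 0] are irrelevant. *)
Definition Wminus (R : realType) : set (R -> R) := [set chi : R -> R |
  [/\ forall t : R, t <= 0 -> chi t <= 0,
      convex_function (`]-oo, 0]%classic : set R^o) (chi : R^o -> R^o),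
      {in `]-oo, 0] &, {homo chi : s t / s <= t}},
      chi 0 = 0 &
      chi t @[t --> -oo] --> -oo]].
Arguments Wminus : clear implicits.

(* Main.v *)
Require Import Defs.
From mathcomp Require Import all_boot all_order all_algebra.
From mathcomp Require Import complex.
From mathcomp Require Import all_classical all_reals all_analysis.
From mathcomp Require Import measurable_realfun lra.
Import Order.TTheory GRing.Theory Num.Theory.
Import numFieldNormedType.Exports.
Local Open Scope classical_set_scope.
Local Open Scope ring_scope.

(** The only inclusion with content asks, for a given phi of full mass, for one
    weight chi with chi(-|phi|) integrable against mu = (omega + dd^c phi)^n.
    This is pure measure theory once two facts are known: phi is Borel, being
    upper semicontinuous ([PSH_measurable]), and mu puts no mass on the poles
    {phi = -oo} ([np_MA_pole]), since mu is a limit of measures carried by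
    the sets {phi > -j}.

    Let then mu be any finite measure and f any measurable function which is
    finite mu-almost everywhere.  The functions min(1, w |f|) are dominated by 1
    and tend to 0 almost everywhere as w -> 0, so the rates w_k can be chosen so
    small that both w_k and the integral of min(1, w_k |f|) are at most 2^-(k+1)
    ([small_integral_capped]).  Put h(s) = sum_k min(1, w_k s).  The bound on w_k
    makes h finite; h is concave and increasing, as a sum of such functions; and
    h(s) tends to +oo because every single term reaches 1.  Hence
    chi(t) = -h(-t) lies in W^- ([capped_weight_Wminus]), while the bounds on the
    integrals give h(|f|) integral at most 1 ([exists_integrable_weight]).

    The hypothesis that omega has positive total mass excludes the junk value of
    the non-pluripolar measure: a zero measure cannot have the mass of omega^n
    ([the_finite_measureP], [Efull_is_np_MA]). *)

Definition capped {R : realType} (w : R) (x : \bar R) : \bar R :=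
  mine 1%E (`|x| * w%:E)%E.

(** The sum is extended-valued so that it can be evaluated at infinite points and
    integrated term by term, without any separate treatment of the poles. *)
Definition capped_series {R : realType} (w : nat -> R) (x : \bar R) : \bar R :=
  (\sum_(k <oo) capped (w k) x)%E.

(** Each term depends on |t| only, which is why no sign change is needed to pass
    from the half-line t <= 0 to the concave function of s = -t. *)
Definition capped_weight {R : realType} (w : nat -> R) (t : R) : R :=
  - fine (capped_series w t%:E).

Lemma capped_EFin {R : realType} (w t : R) :
  capped w t%:E = (Num.min 1 (`|t| * w))%:E.
Proof. by rewrite /capped abse_EFin -EFinM -EFin_min. Qed.

Lemma capped_ge0 {R : realType} (w : R) (x : \bar R) :
  0 <= w -> (0 <= capped w x)%E.
Proof.
by move=> w0; rewrite /capped le_min lee01 mule_ge0// lee_fin.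
Qed.

Lemma capped_le1 {R : realType} (w : R) (x : \bar R) : (capped w x <= 1)%E.
Proof. by rewrite /capped ge_min lexx. Qed.

Lemma capped_infinite {R : realType} (w : R) (x : \bar R) :
  0 < w -> `|x|%E = +oo%E -> capped w x = 1%E.
Proof.
move=> w0 xoo; rewrite /capped xoo gt0_mulye ?lte_fin//.
by apply/min_idPl; rewrite leey.
Qed.

Lemma measurable_capped {d} {T : measurableType d} {R : realType} (w : R)
    (f : T -> \bar R) :
  measurable_fun setT f -> measurable_fun setT (fun x => capped w (f x)).
Proof.
move=> mf; apply: measurable_mine => //.
apply: emeasurable_funM => //; exact: (measurableT_comp (@abse_measurable R setT) mf).
Qed.

(** Dominated convergence along w = 1/(n+1), with the constant 1 as dominating
    function: finiteness of the measure makes 1 integrable, and finiteness of f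
    almost everywhere makes the truncations tend to 0. *)
Lemma small_integral_capped {d} {T : measurableType d} {R : realType}
    (mu : {finite_measure set T -> \bar R}) (f : T -> \bar R) (e : R) :
  measurable_fun setT f -> mu [set x | `|f x|%E = +oo%E] = 0%E -> 0 < e ->
  exists w : R, [/\ 0 < w, w <= e & (\int[mu]_x capped w (f x) <= e%:E)%E].
Proof.
move=> mf f_fin e0.
have [_ _ icvg] : [/\ mu.-integrable setT (fun=> 0%E),
  [sequence (\int[mu]_(x in setT) `|capped (harmonic n) (f x) - 0|)%E]_n
    @ \oo --> 0%E &
  [sequence (\int[mu]_(x in setT) (capped (harmonic n) (f x)))%E]_n
    @ \oo --> (\int[mu]_(x in setT) 0)%E].
  apply: (@dominated_convergence _ _ _ mu setT measurableT
    (fun n x => capped (harmonic n) (f x)) (fun=> 0%E) (EFin \o cst 1)) => //.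
  - by move=> n; exact: measurable_capped.
  - exists [set x | `|f x|%E = +oo%E]; split => //.
      rewrite -[X in measurable X]setTI.
      have mabs : measurable_fun setT (fun x => `|f x|%E).
        exact: (measurableT_comp (@abse_measurable R setT) mf).
      exact: (mabs measurableT _ (emeasurable_set1 +oo%E)).
    move=> x /=; apply: contra_notP => nfx _.
    have : (f x) \is a fin_num by rewrite fin_numE; case: (f x) nfx.
    case: (f x) => [r _| |]//.
    under eq_fun do rewrite capped_EFin.
    apply: cvg_EFin; first by apply: nearW.
    apply: (@squeeze_cvgr _ _ _ _ (fun=> 0) (fun n => `|r| * harmonic n)).
    + by apply: nearW => n /=; rewrite le_min ler01 mulr_ge0//= ge_min lexx orbT.
    + exact: cvg_cst.
    + rewrite -[X in _ --> X](mulr0 `|r|); apply: cvgM; first exact: cvg_cst.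
      exact: cvg_harmonic.
  - exact: finite_measure_integrable_cst.
  - apply/aeW => x n _ /=; rewrite gee0_abs ?capped_le1//.
    by apply: capped_ge0; exact: harmonic_ge0.
rewrite integral0 in icvg.
have [n [Hn1 Hn2]] : exists n, harmonic n <= e /\
    (\int[mu]_x capped (harmonic n) (f x) < e%:E)%E.
  near \oo => n; exists n; split; near: n.
    have := @cvgr0_norm_le _ _ _ _ _ _ (@cvg_harmonic R) e e0.
    by move=> /(_ _); apply: filterS => n; apply: le_trans; exact: ler_norm.
  have : nbhs (0%E : \bar R) [set y | (y < e%:E)%E].
    by apply: open_nbhs_nbhs; split; [exact: open_ereal_lt_ereal|rewrite /= lte_fin].
  by move/icvg.
by exists (harmonic n); split => //; [exact: harmonic_gt0 | exact: ltW].
Unshelve. all: by end_near. Qed.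

(** Termwise comparison with |t| w_k. *)
Lemma capped_series_fin_num {R : realType} (w : nat -> R) (t : R) :
  (forall k, 0 < w k) -> (\sum_(k <oo) (w k)%:E < +oo)%E ->
  capped_series w t%:E \is a fin_num.
Proof.
move=> w0 wfin; have wge0 k : 0 <= w k by exact: ltW.
rewrite ge0_fin_numE; last by apply: nneseries_ge0 => k _ _; exact: capped_ge0.
apply: (@le_lt_trans _ _ (\sum_(k <oo) (`|t|%:E * (w k)%:E))%E).
  apply: lee_nneseries => k *; first exact: capped_ge0.
  by rewrite capped_EFin -EFinM lee_fin ge_min lexx orbT.
rewrite nneseriesZl; last by move=> k _; rewrite lee_fin.
by rewrite lte_mul_pinfty// lee_fin.
Qed.

(** At an infinite point every term equals 1, whatever the rates. *)
Lemma capped_series_infinite {R : realType} (w : nat -> R) (x : \bar R) :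
  (forall k, 0 < w k) -> `|x|%E = +oo%E -> capped_series w x = +oo%E.
Proof.
move=> w0 xoo; apply: eq_infty => r.
pose n := (Num.truncn r).+1.
apply: (@le_trans _ _ n%:R%:E); first by rewrite lee_fin ltW// truncnS_gt.
apply: le_trans (nneseries_lim_ge n _); last first.
  by move=> i _ _; apply: capped_ge0; exact: ltW.
rewrite big_mkord (eq_bigr (fun=> 1%E)) => [|k _]; last exact: capped_infinite.
by rewrite sumEFin sumr_const card_ord.
Qed.

(** Both sides agree at the poles because the series diverges there, as
    [er_map] prescribes.  This identity turns the integrand into a series of
    measurable functions, so measurability of the weight is never at stake. *)
Lemma er_map_capped_weight {R : realType} (w : nat -> R) (x : \bar R) :
  (forall k, 0 < w k) -> (\sum_(k <oo) (w k)%:E < +oo)%E ->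
  er_map (capped_weight w) (- `|x|)%E = (- capped_series w x)%E.
Proof.
move=> w0 wfin; case: x => [t| |] /=; last 2 first.
- by rewrite capped_series_infinite.
- by rewrite capped_series_infinite.
rewrite /capped_weight EFinN fineK ?capped_series_fin_num//; congr (- _)%E.
by apply: eq_eseriesr => k _; rewrite !capped_EFin normrN normr_id.
Qed.

(** Convexity and monotonicity hold term by term.  For the limit at -oo: as soon
    as |t| exceeds 1/w_k for the first n indices k, the first n terms equal 1 and
    the weight is at most -n. *)
Lemma capped_weight_Wminus {R : realType} (w : nat -> R) :
  (forall k, 0 < w k) -> (\sum_(k <oo) (w k)%:E < +oo)%E ->
  Wminus R (capped_weight w).
Proof.
move=> w0 wfin; have wge0 k : 0 <= w k by exact: ltW.
have hfin t := capped_series_fin_num w t w0 wfin.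
have h0 x : (0 <= capped_series w x)%E.
  by apply: nneseries_ge0 => k _ _; exact: capped_ge0.
split.
- by move=> t _; rewrite oppr_le0 fine_ge0.
- move=> p a b; rewrite !inE/= !in_itv/= => a0 b0.
  (* unfold the convex combinations of the real line *)
  change (capped_weight w (p%:num * a + (1 - p%:num) * b) <=
    p%:num * capped_weight w a + (1 - p%:num) * capped_weight w b).
  rewrite /capped_weight !mulrN -opprD.
  rewrite lerN2 -lee_fin EFinD !EFinM !fineK//.
  rewrite -!nneseriesZl; [|by move=> k _; exact: capped_ge0..].
  have p0 : 0 <= p%:num by [].
  have p1 : 0 <= 1 - p%:num by rewrite subr_ge0.
  rewrite -nneseriesD; last 2 first.
  - by move=> k _ _; rewrite mule_ge0 ?lee_fin ?capped_ge0.
  - by move=> k _ _; rewrite mule_ge0 ?lee_fin ?capped_ge0.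
  apply: lee_nneseries => k.
    by move=> _ _; rewrite adde_ge0// mule_ge0 ?lee_fin ?capped_ge0.
  move=> _.
  rewrite !capped_EFin -!EFinM -EFinD lee_fin.
  have ab0 : p%:num * a + (1 - p%:num) * b <= 0 by nra.
  rewrite !ler0_norm//.
  rewrite le_min; apply/andP; split.
    apply: (@le_trans _ _ (p%:num * 1 + (1 - p%:num) * 1)); last by lra.
    by apply: lerD; apply: ler_wpM2l => //; rewrite ge_min lexx.
  apply: (@le_trans _ _ (p%:num * (- a * w k) + (1 - p%:num) * (- b * w k))).
    by apply: lerD; apply: ler_wpM2l => //; rewrite ge_min lexx orbT.
  by lra.
- move=> s t; rewrite !in_itv/= => s0 t0 st.
  rewrite /capped_weight lerN2 -lee_fin !fineK//.
  apply: lee_nneseries => k *; first exact: capped_ge0.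
  rewrite !capped_EFin lee_fin !ler0_norm//.
  have : - t * w k <= - s * w k by apply: ler_wpM2r => //; rewrite lerN2.
  by move=> ts; rewrite le_min !ge_min lexx ts orbT.
- rewrite /capped_weight /capped_series eseries0 ?oppr0// => k _ _.
  by rewrite capped_EFin normr0 mul0r min_r.
- apply/cvgrNyPle => B.
  pose n := (Num.truncn (- B)).+1.
  have Bn : - B <= n%:R by apply: ltW; exact: truncnS_gt.
  have : \forall t \near -oo, forall k : 'I_n, t <= - (w k)^-1.
    apply: filter_forall => k; apply: nbhs_ninfty_le; exact: num_real.
  apply: filterS => t tw.
  rewrite /capped_weight lerNl -lee_fin fineK//.
  apply: le_trans (nneseries_lim_ge n _); last first.
    by move=> i _ _; exact: capped_ge0.
  rewrite big_mkord.
  rewrite (eq_bigr (fun=> 1%E)) => [|k _].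
    by rewrite sumEFin sumr_const card_ord lee_fin.
  rewrite capped_EFin min_l// ler0_norm; last first.
    by rewrite (le_trans (tw k))// oppr_le0 invr_ge0.
  by rewrite -ler_pdivrMr// div1r lerNr.
Qed.

(** A de la Vallee-Poussin type statement: finiteness almost everywhere is
    already integrability for some concave, unbounded growth rate. *)
Lemma exists_integrable_weight {d} {T : measurableType d} {R : realType}
    (mu : {finite_measure set T -> \bar R}) (f : T -> \bar R) :
  measurable_fun setT f -> mu [set x | `|f x|%E = +oo%E] = 0%E ->
  exists2 chi, Wminus R chi &
    mu.-integrable setT (fun x => er_map chi (- `|f x|)%E).
Proof.
move=> mf f_fin.
(* the bounds 2^-(k+1), of sum 1, in the form used for geometric series *)
pose e (k : nat) : R := 1 / (2 ^ (k + 1))%:R.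
have e0 k : 0 < e k by rewrite divr_gt0// ltr0n expn_gt0.
have esum : (\sum_(k <oo) (e k)%:E = 1)%E.
  have /cvg_lim := @cvg_geometric_eseries_half R 1 0.
  by rewrite expr0 divr1 => <-//.
have /choice[w wP] k := small_integral_capped mu f (e k) mf f_fin (e0 k).
have w0 k : 0 < w k by have [] := wP k.
have wfin : (\sum_(k <oo) (w k)%:E < +oo)%E.
  apply: (@le_lt_trans _ _ (\sum_(k <oo) (e k)%:E)%E); last by rewrite esum ltry.
  apply: lee_nneseries => k *; first by rewrite lee_fin ltW.
  by rewrite lee_fin; have [] := wP k.
exists (capped_weight w); first exact: capped_weight_Wminus.
have c0 k x : (0 <= capped (w k) (f x))%E by apply: capped_ge0; exact: ltW.
under eq_fun do rewrite er_map_capped_weight//.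
apply: (@integrableN _ _ _ mu setT (fun x => capped_series w (f x))).
apply/integrableP; split.
  apply: ge0_emeasurable_sum => // k _; exact: measurable_capped.
under eq_integral do rewrite gee0_abs ?nneseries_ge0//.
rewrite integral_nneseries//; last by move=> k; exact: measurable_capped.
apply: (@le_lt_trans _ _ (\sum_(k <oo) (e k)%:E)%E); last by rewrite esum ltry.
apply: lee_nneseries => k *; first exact: integral_ge0.
by have [] := wP k.
Qed.

(** The default is the zero measure, so any nonzero mass certifies that the
    characterizing property is satisfied. *)
Lemma the_finite_measureP {R : realType} {d} {T : measurableType d}
    (P : {finite_measure set T -> \bar R} -> Prop) :
  the_finite_measure P setT != 0%E -> P (the_finite_measure P).
Proof.
rewrite /the_finite_measure; case: pselect => [h _|_]; first exact: projT2 (cid h).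
by rewrite /mzero eqxx.
Qed.

Lemma Efull_is_np_MA {R : realType} {n : nat} {X : ptopologicalType}
    (A : set (chart R n X)) (omega : current R n X) (phi : X -> \bar R) :
  (0 < MA A omega setT)%E -> Efull A omega phi ->
  is_np_MA A omega phi (np_MA A omega phi).
Proof.
move=> MA0 [_ mass]; apply: the_finite_measureP.
by rewrite -/(np_MA A omega phi) mass gt_eqF.
Qed.

(** The complements of the sets {phi >= a}, which generate the Borel structure of
    the target, are open by upper semicontinuity. *)
Lemma PSH_measurable {R : realType} {n : nat} {X : ptopologicalType}
    (A : set (chart R n X)) (omega : current R n X) (phi : X -> \bar R) :
  PSH A omega phi -> measurable_fun [set: borel X] (phi : borel X -> \bar R).
Proof.
move=> [_ usc _ _].
apply: (measurability _ (ErealGenCInfty.measurableE R)) => // _ [_ [a ->] <-].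
rewrite setTI -[X in measurable X]setCK; apply: measurableC.
apply: sub_sigma_algebra; rewrite openE => x /=.
rewrite in_itv/= andbT => /negP; rewrite -ltNge => /usc.
by apply: filterS => y ya /=; rewrite in_itv/= andbT; apply/negP; rewrite -ltNge.
Qed.

(** The pole set is disjoint from every {phi > -j}, so the sequence converging to
    its mass is constantly 0.  As phi < +oo, the poles are exactly the points
    where |phi| is infinite. *)
Lemma np_MA_pole {R : realType} {n : nat} {X : ptopologicalType}
    (A : set (chart R n X)) (omega : current R n X) (phi : X -> \bar R)
    (mu : {finite_measure set (borel X) -> \bar R}) :
  PSH A omega phi -> is_np_MA A omega phi mu ->
  mu [set x : borel X | `|phi x|%E = +oo%E] = 0%E.
Proof.
move=> psh mu_np.
have mphi := PSH_measurable A omega phi psh.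
set B := (B in mu B).
have mB : measurable B.
  have mabs : measurable_fun [set: borel X] (fun x => `|phi x|%E).
    exact: (measurableT_comp (@abse_measurable R setT) mphi).
  rewrite -[B]setTI; exact: (mabs measurableT _ (emeasurable_set1 +oo%E)).
have := mu_np B mB.
have [phi_lt_oo _ _ _] := psh.
have empty j : B `&` [set x | ((- j%:R)%:E < phi x)%E] = set0.
  apply/seteqP; split => // x [/=].
  by rewrite /B /=; case: (phi x) (phi_lt_oo x).
under eq_fun do rewrite empty measure0.
by move=> /(cvg_lim (@ereal_hausdorff R)) <-; rewrite lim_cst.
Qed.

Theorem proposition2p2 (R : realType) (n : nat) (X : ptopologicalType)
    (A : set (chart R n X)) (omega : current R n X) :
  (1 <= n)%N ->
  compact [set: X] -> connected [set: X] -> hausdorff_space X ->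
  complex_atlas A -> kahler A ->
  is_current A omega -> positive_current A omega -> closed_current A omega ->
  bounded_potentials A omega ->
  (0 < MA A omega [set: X])%E ->
  Efull A omega = \bigcup_(chi in Wminus R) Echi A omega chi.
Proof.
move=> _ _ _ _ _ _ _ _ _ _ MA0; apply/seteqP; split => [phi full|phi [chi _ []//]].
have [psh _] := full.
have [chi Wchi ichi] := exists_integrable_weight (np_MA A omega phi) phi
  (PSH_measurable A omega phi psh)
  (np_MA_pole A omega phi _ psh (Efull_is_np_MA A omega phi MA0 full)).
by exists chi.
Qed.
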